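(* Consider the limiting model of the $p$-SOS model as $p\to\infty$, i.e. the $\infty$-SOS model, with parameter $\theta>0$, spin values $\{0,1,2\}$ (i.e. $m=2$), on the Cayley tree of order $k=2$. Then there exist critical values $\theta_0\approx0.135$ and $\theta_0'=(\sqrt5-1)/4\approx 0.309$ such that the following hold. 1. If $\theta>\theta_0'$, then there is a unique translation-invariant splitting Gibbs measure. 2. If $\theta=\theta_0'$, then there are exactly three translation-invariant splitting Gibbs measures. 3. If $\theta\in(\theta_0,\theta_0')$, then there are exactly five translation-invariant splitting Gibbs measures. 4. If $\theta=\theta_0$, then there are exactly six translation-invariant splitting Gibbs measures. 5. If $\theta\in(0,\theta_0)$, then there are exactly seven translation-invariant splitting Gibbs measures.
   Context: Cayley tree of order $k$: the infinite tree $\Gamma^k=(V,L)$ in which each vertex has exactly $k+1$ neighbors, with a fixed root $x^0\in V$ and graph distance $d$. Write $V_n=\{x\in V: d(x,x^0)\le n\}$ and $W_n=\{x\in V: d(x,x^0)=n\}$. $p$-SOS model: the model with formal Hamiltonian $H(\sigma)=-J\sum_{\langle x,y\rangle}|\sigma(x)-\sigma(y)|^p$, $\theta=\exp(J)$. For $k=m=2$ its translation-invariant splitting Gibbs measures correspond to positive solutions $(x,y)$ of $x=\frac{x^2+\theta y^2+\theta^{2^p}}{\theta^{2^p}x^2+\theta y^2+1}$, $y=\frac{\theta x^2+y^2+\theta}{\theta^{2^p}x^2+\theta y^2+1}$; for $\theta<1$ these equations converge, as $p\to\infty$, to the equations of the $\infty$-SOS model (with $x=\sqrt{z_0}$, $y=\sqrt{z_1}$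 in the notation below). $\infty$-SOS model with $m=2$: spins take values in $\{0,1,2\}$. A configuration $\sigma$ on $A\subseteq V$ is admissible if $|\sigma(x)-\sigma(y)|\in\{0,1\}$ for every edge $\langle x,y\rangle$ with both endpoints in $A$. Let $\Omega$ be the set of admissible configurations on $V$ and $\Omega_A$ the set of admissible configurations on $A$. The activities are $\lambda_{i,i}=1$ and $\lambda_{i,j}=\theta$ if $|i-j|=1$, where $\theta>0$ (pairs with $|i-j|\ge2$ are forbidden). Splitting Gibbs measure (SGM): given positive vectors $z_x=(z_{0,x},z_{1,x},z_{2,x})$, $x\in V\setminus\{x^0\}$, normalized by $z_{2,x}=1$, define for $n\ge1$ the probability measure on $\Omega_{V_n}$ $$\mu^{(n)}(\sigma_n)=\frac1{Z_n}\prod_{\langle x,y\rangle\subset V_n}\lambda_{\sigma_n(x),\sigma_n(y)}\prod_{x\in W_n}z_{\sigma_n(x),x},$$ where $Z_n$ is the normalizing constant. The sequence $(\mu^{(n)})_{n\ge1}$ is compatible if for all $n\ge2$ the marginal of $\mu^{(n)}$ on $V_{n-1}$ equals $\mu^{(n-1)}$. In that case the unique probability measure $\mu$ on $\Omega$ whose marginal on each $V_n$ is $\mu^{(n)}$ is called the SGM corresponding to $z$. A translation-invariant SGM is an SGM corresponding to a function $z$ that is constant, $z_x\equiv z=(z_0,z_1,1)$. Compatibility for constant $z$ amounts to the system $$z_0=\Big(\frac{z_0+\theta z_1}{\theta z_1+1}\Big)^k,\qquad z_1=\Big(\frac{\theta z_0+z_1+\theta}{\theta z_1+1}\Big)^k,\qquad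 z_0,z_1>0,$$ and the translation-invariant SGMs are counted by the positive solutions $(z_0,z_1)$ of this system. *)

(* Defs.v *)
From HB Require Import structures.
From mathcomp Require Import all_boot all_order all_algebra finmap.
From mathcomp Require Import all_classical all_reals all_analysis.
Set Implicit Arguments.
Unset Strict Implicit.
Unset Printing Implicit Defensive.
Import Order.TTheory GRing.Theory Num.Theory.
Local Open Scope classical_set_scope.
Local Open Scope ring_scope.

(* [tree_path] is the characterisation of trees as the graphs in which any two
   vertices are joined by exactly one simple path.  Regularity of degree k.+1
   makes the tree infinite as soon as 0 < k. *)
Record cayley_tree (k : nat) := CayleyTree {
  vertex :> choiceType;
  adj : rel vertex;
  tree_root : vertex;
  adj_sym : symmetric adj;
  adj_irr : irreflexive adj;
  adj_degree : forall x, exists nb : seq vertex,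
    [/\ uniq nb, size nb = k.+1 & forall y, adj x y = (y \in nb)];
  tree_path : forall x y, exists! p : seq vertex,
    [/\ path adj x p, last x p = y & uniq (x :: p)] }.
Arguments tree_root {k} c.
Arguments adj {k} c _ _.

Section Tree.
Context {k : nat} (T : cayley_tree k).

Definition walk_of_length (x y : T) (n : nat) : Prop :=
  exists p : seq T, [/\ path (adj T) x p, last x p = y & size p = n].

Lemma walk_exists (x y : T) : exists n, `[< walk_of_length x y n >].
Proof.
have [p [[px lxp _] _]] := tree_path x y.
by exists (size p); apply/asboolP; exists p.
Qed.

Definition dist (x y : T) : nat := ex_minn (walk_exists x y).

Lemma finite_Vn (n : nat) : finite_set [set x : T | (dist (tree_root T) x <= n)%N].
Proof.
have fW m : finite_set [set x : T | walk_of_length (tree_root T) x m].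
  elim: m => [|m IH].
    apply: (@sub_finite_set _ _ [set tree_root T]) => // x /= [p [_ <- /size0nil ->]].
    by [].
  pose N (x : T) := [set y : T | adj T x y].
  apply: (@sub_finite_set _ _ (\bigcup_(x in
      [set x : T | walk_of_length (tree_root T) x m]) N x)).
    move=> x /= [p]; case/lastP: p => [[]//|p y].
    rewrite rcons_path last_rcons size_rcons => -[/andP[pp ay] <- [sp]].
    by exists (last (tree_root T) p) => //=; exists p.
  apply: bigcup_finite => // x _.
  have [nb [_ _ nbP]] := adj_degree x.
  apply: (@sub_finite_set _ _ [set` nb]); last exact: finite_seq.
  by move=> y; rewrite /N /= nbP.
apply: (@sub_finite_set _ _ (\bigcup_(m in `I_n.+1)
    [set x : T | walk_of_length (tree_root T) x m])).
  move=> x /=; rewrite /dist; case: ex_minnP => m /asboolP wm _ mn.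
  by exists m.
by apply: bigcup_finite => //; exact: finite_II.
Qed.

(* [fset_set A] is A when A is finite, and fset0 otherwise; see [finite_Vn]. *)
Definition Vn (n : nat) : {fset T} :=
  fset_set [set x : T | (dist (tree_root T) x <= n)%N].

Definition conf (A : {fset T}) := {ffun A -> 'I_3}.

Definition allowed (i j : 'I_3) : bool := `|i%:Z - j%:Z| <= 1.

Definition Omega_fin (A : {fset T}) : {set conf A} :=
  [set s : conf A | [forall x, forall y,
      adj T (val x) (val y) ==> allowed (s x) (s y)]]%SET.

Definition Omega :=
  {s : T -> 'I_3 | forall x y, adj T x y -> allowed (s x) (s y)}.

HB.instance Definition _ := gen_eqMixin Omega.
HB.instance Definition _ := gen_choiceMixin Omega.

Lemma const_admissible (x y : T) : adj T x y -> allowed ord0 ord0.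
Proof. by []. Qed.

HB.instance Definition _ :=
  isPointed.Build Omega (exist _ (fun=> ord0) const_admissible).

Definition evaluations : set (set Omega) :=
  [set C | exists (x : T) (i : 'I_3), C = [set s | sval s x = i]].

Definition OmegaM := g_sigma_algebraType evaluations.

Definition restr (A : {fset T}) (s : Omega) : conf A :=
  [ffun x : A => sval s (val x)].

Definition extends (A B : {fset T}) (s : conf A) (t : conf B) : bool :=
  [forall x : A, forall y : B, (val x == val y) ==> (s x == t y)].

Section Measures.
Context {R : realType}.
Context (theta : R).

Definition activity (i j : 'I_3) : R :=
  if i == j then 1 else if `|i%:Z - j%:Z| == 1 then theta else 0.

(* The distances to the root of the two endpoints of an edge of a tree differ
   by exactly one, so ordering them by that distance lists each unordered edge
   exactly once. *)
Definition weight (z : T -> 'I_3 -> R) (n : nat) (s : conf (Vn n)) : R :=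
  (\prod_(e : Vn n * Vn n |
          adj T (val e.1) (val e.2) &&
          (dist (tree_root T) (val e.1) < dist (tree_root T) (val e.2))%N)
      activity (s e.1) (s e.2)) *
  \prod_(x : Vn n | dist (tree_root T) (val x) == n) z (val x) (s x).

Definition Zn (z : T -> 'I_3 -> R) (n : nat) : R :=
  \sum_(s in Omega_fin (Vn n)) weight z s.

Definition mu_n (z : T -> 'I_3 -> R) (n : nat) (s : conf (Vn n)) : R :=
  weight z s / Zn z n.

Definition compatible_seq (z : T -> 'I_3 -> R) : Prop :=
  forall n : nat, (2 <= n)%N ->
  forall s : conf (Vn n.-1), s \in Omega_fin (Vn n.-1) ->
    \sum_(t in Omega_fin (Vn n) | extends s t) mu_n z t = mu_n z s.

(* The value of z at the root is never used. *)
Definition is_SGM (z : T -> 'I_3 -> R) (mu : probability OmegaM R) : Prop :=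
  [/\ forall x, x != tree_root T -> (forall i, 0 < z x i) /\ z x ord_max = 1,
      compatible_seq z &
      forall n : nat, (1 <= n)%N ->
      forall s : conf (Vn n), s \in Omega_fin (Vn n) ->
        mu [set w : OmegaM | restr (Vn n) w = s] = (mu_n z s)%:E].

Definition is_TISGM (mu : probability OmegaM R) : Prop :=
  exists c : 'I_3 -> R, is_SGM (fun=> c) mu.

End Measures.
End Tree.

(* A library measure is a function on all subsets, unconstrained outside the
   sigma-algebra, so measures are compared on measurable sets only. *)
Definition same_measure {d} {X : measurableType d} {R : realType}
    (mu nu : probability X R) : Prop :=
  forall A : set X, measurable A -> mu A = nu A.

Definition exactly {d} {X : measurableType d} {R : realType} (n : nat)
    (P : probability X R -> Prop) : Prop :=
  exists mus : 'I_n -> probability X R,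
    [/\ forall i, P (mus i),
        forall i j, same_measure (mus i) (mus j) -> i = j &
        forall mu, P mu -> exists i, same_measure mu (mus i)].

(* Main.v *)
Require Import Defs.
From HB Require Import structures.
From mathcomp Require Import all_boot all_order all_algebra finmap.
From mathcomp Require Import all_classical all_reals all_analysis.
From mathcomp Require Import ring lra.
Set Implicit Arguments.
Unset Strict Implicit.
Unset Printing Implicit Defensive.
Import Order.TTheory GRing.Theory Num.Theory.
Local Open Scope ring_scope.

(* Summing out the outermost sphere turns the weight of a configuration into the
   weight of its restriction, each boundary factor z_i being replaced by the k-th
   power of sum_j lambda_ij z_j; comparing constant configurations on the ball of
   radius 1 shows that compatibility is equivalent to the fixed point system.
   Compatible finite-volume distributions are realised on [0, 1[ with Lebesgue
   measure: at level n the configurations label half-open intervals of length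
   mu_n, nested along restriction, and a point of [0, 1[ determines the
   configuration all of whose restrictions label an interval containing it.
   With z0 = x^2 and z1 = y^2 the first equation of the system becomes
   (x - 1) (x - theta y^2) = 0. The branch x = 1 leaves the cubic
   theta y^3 - y^2 + y - 2 theta, with 1, 2 or 3 roots according to the sign of its
   discriminant, which decreases in theta and vanishes at theta0. The branch
   x = theta y^2 leaves a reciprocal quartic with 4, 2 or 0 positive roots for theta
   below, at or above theta0'. The branches never meet. *)

(** * Solutions of the system *)

Section Solutions.
Context {R : rcfType}.
Implicit Types (a b c x y v theta : R) (s : seq R).

Lemma quadratic_roots a b c : a != 0 ->
  exists s, [/\ uniq s, forall x, (x \in s) = (a * x ^+ 2 + b * x + c == 0) &
    [/\ b ^+ 2 - 4 * a * c < 0 -> size s = 0%N,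
        b ^+ 2 - 4 * a * c = 0 -> size s = 1%N &
        0 < b ^+ 2 - 4 * a * c -> size s = 2%N]].
Proof.
move=> a0; set D := _ - _.
have a2 : 2 * a != 0 by rewrite mulf_neq0 // pnatr_eq0.
have sqE x : 4 * a * (a * x ^+ 2 + b * x + c) = (2 * a * x + b) ^+ 2 - D.
  by rewrite /D; ring.
have rootE x : (a * x ^+ 2 + b * x + c == 0) = ((2 * a * x + b) ^+ 2 == D).
  rewrite -[RHS]subr_eq0 -sqE mulf_eq0 [in RHS]mulf_eq0 (negbTE a0) orbF.
  by rewrite pnatr_eq0.
have linE x y : (2 * a * x + b == y) = (x == (y - b) / (2 * a)).
  by rewrite -subr_eq0 -[RHS](inj_eq (mulfI a2)) mulrCA divff // mulr1
     -[RHS]subr_eq0 opprB addrA.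
have [D0|D0|D0] := ltgtP D 0.
- exists [::]; split=> //; last by split=> // D1; move: D0; rewrite D1 ltxx.
  move=> x; rewrite rootE in_nil; apply/esym/negbTE/eqP => h.
  by move: D0; rewrite -h ltNge sqr_ge0.
- set r := Num.sqrt D.
  have r0 : 0 < r by rewrite sqrtr_gt0.
  exists [:: (r - b) / (2 * a); (- r - b) / (2 * a)]; split=> //=.
    rewrite andbT inE; apply/eqP => /(mulIf _); rewrite invr_eq0 => /(_ a2) h.
    by move: r0; lra.
    move=> x; rewrite rootE -(sqr_sqrtr (ltW D0)) -/r eqf_sqr !inE !linE //.
  by split=> // D1; move: D0; rewrite D1 ltxx.
- exists [:: - b / (2 * a)]; split=> // x.
  by rewrite rootE D0 sqrf_eq0 linE inE sub0r.
Qed.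

(** * The cubic of the branch x = 1 and the first critical value *)

Lemma cubic_root theta : 0 < theta ->
  exists x, theta * x ^+ 3 - x ^+ 2 + x - 2 * theta = 0.
Proof.
move=> t0; pose p : {poly R} := theta *: 'X^3 - 'X^2 + 'X - (2 * theta)%:P.
have pE x : p.[x] = theta * x ^+ 3 - x ^+ 2 + x - 2 * theta.
  by rewrite /p !hornerE.
(* At [M] the cubic is nonnegative: theta M > 1 lets the cubic term absorb M^2, and M - 2 theta = 1
   / theta. *)
pose M := theta^-1 + 2 * theta.
have i0 : 0 < theta^-1 by rewrite invr_gt0.
have [||x _ /rootP] := @poly_ivt R p 0 M.
- by rewrite /M; lra.
- rewrite !pE /=; apply/andP; split; first by lra.
  have -> : theta * M ^+ 3 = M ^+ 2 + 2 * theta ^+ 2 * M ^+ 2.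
    rewrite exprS mulrA; have -> : theta * M = 1 + 2 * theta ^+ 2.
      by rewrite /M mulrDr mulfV ?gt_eqF//; ring.
    by ring.
  have : 0 <= 2 * theta ^+ 2 * M ^+ 2.
    by rewrite mulr_ge0 ?sqr_ge0 // mulr_ge0 // sqr_ge0.
  have : M = theta^-1 + 2 * theta by [].
  by lra.
by rewrite pE; exists x.
Qed.

(** The discriminant of theta y^3 - y^2 + y - 2 theta. *)
Definition cubic_disc theta := 1 - 12 * theta + 36 * theta ^+ 2 - 108 * theta ^+ 4.

(** With r a root and q the quadratic cofactor, the discriminant is that of q times q(r)^2. If q(r)
    is nonzero, the roots are r and those of q; otherwise they are those of q alone, two in number
    since a triple root cannot occur. *)
Lemma cubic_roots theta : 0 < theta ->
  exists s, [/\ uniq s,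
    forall y, (y \in s) = (theta * y ^+ 3 - y ^+ 2 + y - 2 * theta == 0) &
    [/\ cubic_disc theta < 0 -> size s = 1%N,
        cubic_disc theta = 0 -> size s = 2%N &
        0 < cubic_disc theta -> size s = 3%N]].
Proof.
move=> t0; have [r r0] := cubic_root t0.
pose b := theta * r - 1; pose c := r * b + 1.
pose q x := theta * x ^+ 2 + b * x + c.
have factor x : theta * x ^+ 3 - x ^+ 2 + x - 2 * theta = (x - r) * q x.
  rewrite -[RHS]addr0 -r0 /q /c /b; ring.
have discE : cubic_disc theta = (b ^+ 2 - 4 * theta * c) * q r ^+ 2.
  apply/eqP; rewrite eq_sym -subr_eq0; apply/eqP.
  (* The cofactor is the quotient of the difference by the cubic in [r]. *)
  transitivity ((theta * r ^+ 3 - r ^+ 2 + r - 2 * theta) *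
      (- 27 * r ^+ 3 * theta ^+ 3 + 27 * r ^+ 2 * theta ^+ 2
       - 27 * r * theta ^+ 2 + 18 * theta - 4 - 54 * theta ^+ 3)).
    by rewrite /cubic_disc /q /c /b; ring.
  by rewrite r0 mul0r.
have [s [us sP [s0 s1 s2]]] := quadratic_roots b c (lt0r_neq0 t0).
rewrite discE; have [qr0|qr0] := eqVneq (q r) 0.
  exists s; split=> //.
    move=> y; rewrite sP factor mulf_eq0 subr_eq0 -/(q y).
    by have [->|] := eqVneq y r; rewrite ?qr0 ?eqxx.
  rewrite qr0 expr0n mulr0 ltxx; split=> // _.
  have : r \in s by rewrite sP -/(q r) qr0.
  have [D0|D0|D0] := ltgtP (b ^+ 2 - 4 * theta * c) 0.
  - by rewrite (size0nil (s0 D0)).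
  - by rewrite s2.
  (* A vanishing discriminant of q would make r a triple root, forcing theta = 1/3 and r = 1, where
     the cubic equals -1/3. *)
  have t3 : theta = 1 / 3.
    have : b ^+ 2 - 4 * theta * c + theta * q r = 1 - 3 * theta.
      by rewrite /q /c /b; ring.
    by rewrite D0 qr0 mulr0 addr0; lra.
  have : (r - 1) ^+ 2 = q r by rewrite /q /c /b t3; field.
  rewrite qr0 => /eqP; rewrite sqrf_eq0 subr_eq0 => /eqP r1.
  by exfalso; move: r0; rewrite r1 t3 !expr1n; lra.
have q2 : 0 < q r ^+ 2 by rewrite exprn_even_gt0.
exists (r :: s); split=> /=.
- by rewrite us sP -/(q r) qr0.
- by move=> y; rewrite inE sP factor mulf_eq0 subr_eq0.
rewrite pmulr_llt0 // pmulr_lgt0 //; split=> [/s0->|/eqP|/s2->] //.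
by rewrite mulf_eq0 (gt_eqF q2) orbF => /eqP /s1 ->.
Qed.

Lemma cubic_root_gt0 theta y : 0 < theta ->
  theta * y ^+ 3 - y ^+ 2 + y - 2 * theta = 0 -> 0 < y.
Proof.
move=> t0 h; rewrite ltNge; apply/negP => y0.
have : theta * y ^+ 3 <= 0.
  by rewrite exprS mulrCA mulr_le0_ge0 // mulr_ge0 ?sqr_ge0 // ltW.
by have := sqr_ge0 y; lra.
Qed.


Lemma cubic_disc_decr theta t : 0 < theta -> theta < t -> cubic_disc t < cubic_disc theta.
Proof.
move=> t0 tt; rewrite -subr_gt0.
have -> : cubic_disc theta - cubic_disc t =
  (t - theta) * (12 - 36 * (t + theta) + 54 * (t + theta) ^+ 3
    + 54 * (t + theta) * (t - theta) ^+ 2).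
  by rewrite /cubic_disc; ring.
rewrite mulr_gt0 ?subr_gt0 //; set S := t + theta.
have S0 : 0 < S by rewrite addr_gt0 // (lt_trans t0).
have : 0 <= 54 * S * (t - theta) ^+ 2 by rewrite mulr_ge0 ?sqr_ge0 // mulr_ge0 // ltW.
suff : 0 < 12 - 36 * S + 54 * S ^+ 3 by lra.
(* 9/19 approximates sqrt 2 / 3, the positive minimiser of 12 - 36 S + 54 S^3. With a = 9/19 the
   product is S^3 - 3 a^2 S + 2 a^3. *)
have : 0 <= (S - 9 / 19) ^+ 2 * (S + 18 / 19).
  by apply: mulr_ge0; [exact: sqr_ge0 | lra].
by lra.
Qed.

Lemma critical_theta0 : exists theta0,
  [/\ `|theta0 - 135 / 1000| < 5 / 10000, cubic_disc theta0 = 0,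
    forall theta, 0 < theta -> theta < theta0 -> 0 < cubic_disc theta &
    forall theta, theta0 < theta -> cubic_disc theta < 0].
Proof.
pose p : {poly R} := 12 *: 'X - 1 - 36 *: 'X^2 + 108 *: 'X^4.
have pE x : p.[x] = - cubic_disc x.
  by rewrite /p /cubic_disc !hornerE; ring.
(* The discriminant changes sign between these two fractions, both within 5/10000 of 0.135. *)
have [||x /andP[x1 x2] /rootP] := @poly_ivt R p (7 / 52) (5 / 37).
- by lra.
- by rewrite !pE /cubic_disc; apply/andP; split; lra.
rewrite pE => /eqP; rewrite oppr_eq0 => /eqP x0; exists x; split=> //.
- by rewrite ltr_norml; apply/andP; split; lra.
- by move=> t t0 tx; rewrite -x0; exact: cubic_disc_decr.
- by move=> t tx; rewrite -x0; apply: cubic_disc_decr => //; lra.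
Qed.

(** * The second critical value and the reciprocal quartic *)

Definition theta0' : R := (Num.sqrt 5 - 1) / 4.

(** Together with positivity, this equation replaces the square root in the later inequalities,
    which become polynomial. *)
Lemma theta0'_eq : 4 * theta0' ^+ 2 + 2 * theta0' = 1.
Proof.
have h5 : Num.sqrt 5 ^+ 2 = 5 :> R by rewrite sqr_sqrtr.
rewrite /theta0'; have -> : 4 * ((Num.sqrt 5 - 1) / 4) ^+ 2 + 2 * ((Num.sqrt 5 - 1) / 4) =
  (Num.sqrt 5 ^+ 2 - 1) / 4 :> R by field.
by rewrite h5; lra.
Qed.

Lemma theta0'_gt0 : 0 < theta0'.
Proof.
have : 1 < Num.sqrt 5 :> R by rewrite -[X in X < _]sqrtr1 ltr_sqrt; lra.
by rewrite /theta0'; lra.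
Qed.

Lemma theta0'_approx : `|theta0' - 309 / 1000| < 5 / 10000.
Proof.
have := theta0'_eq; have := theta0'_gt0; set t := theta0' => t0 t1.
by rewrite ltr_norml; apply/andP; split; nra.
Qed.

(** The discriminant of theta v^2 - v + (1 - 2 theta^2) in v. *)
Definition reciprocal_disc theta := (2 * theta - 1) * (4 * theta ^+ 2 + 2 * theta - 1).

(** 1/2 is the other positive zero of the discriminant, beyond which it is positive again. *)
Lemma reciprocal_disc_lt0 theta : theta0' < theta -> theta < 1 / 2 -> reciprocal_disc theta < 0.
Proof.
have := theta0'_eq; have := theta0'_gt0; set t := theta0' => t0 t1 h1 h2.
by rewrite /reciprocal_disc nmulr_rlt0; [nra | lra].
Qed.

Lemma reciprocal_disc_gt0 theta : 0 < theta -> theta < theta0' -> 0 < reciprocal_disc theta.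
Proof.
have := theta0'_eq; have := theta0'_gt0; set t := theta0' => t0 t1 h1 h2.
by rewrite /reciprocal_disc nmulr_rgt0; nra.
Qed.

(* The value of the quadratic in v at v = 2 t, the minimum of theta y + 1 / y,
   when theta = t ^ 2. *)
Lemma quartic_critical t : 0 < 2 * t ^+ 4 - 2 * t + 1 :> R.
Proof.
(* The squares are centred near the minimiser 4^(-1/3), where t^2 is close to 2/5 and t to 5/8. *)
have -> : 2 * t ^+ 4 - 2 * t + 1 =
  2 * (t ^+ 2 - 2 / 5) ^+ 2 + 8 / 5 * (t - 5 / 8) ^+ 2 + 11 / 200 by field.
by have := sqr_ge0 (t ^+ 2 - 2 / 5); have := sqr_ge0 (t - 5 / 8); lra.
Qed.

(** The bound on v^2 makes theta y + 1 / y = v solvable by two distinct y. With t = sqrt theta <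
    3/5, the quadratic in v decreases up to 2 t and is positive there, so every root exceeds 2 t. *)
Lemma reciprocal_root theta v : 0 < theta -> theta <= theta0' ->
  theta * v ^+ 2 - v + (1 - 2 * theta ^+ 2) = 0 -> 0 < v /\ 4 * theta < v ^+ 2.
Proof.
have [eq0 gt0] := (theta0'_eq, theta0'_gt0) => t0 tt; set c := theta0' in eq0 gt0 tt.
have c1 : c < 31 / 100 by nra.
pose t := Num.sqrt theta; have tE : theta = t ^+ 2 by rewrite sqr_sqrtr // ltW.
have tp : 0 < t by rewrite sqrtr_gt0.
have tl : t < 3 / 5 by nra.
move=> v0; have vp : 0 < v.
  rewrite ltNge; apply/negP => vn.
  have : 0 <= theta * v ^+ 2 by rewrite mulr_ge0 ?sqr_ge0 // ltW.
  by nra.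
split=> //; suff : 2 * t < v by rewrite tE => h; nra.
rewrite ltNge; apply/negP => vl.
have := quartic_critical t.
have -> : 2 * t ^+ 4 - 2 * t + 1 = theta * v ^+ 2 - v + (1 - 2 * theta ^+ 2)
  - (2 * t - v) * (1 - t ^+ 2 * (v + 2 * t)) by rewrite tE; ring.
rewrite v0 sub0r oppr_gt0 ltNge mulr_ge0 ?subr_ge0 //.
have : t ^+ 2 * (v + 2 * t) <= t ^+ 2 * (4 * t).
  by rewrite ler_wpM2l ?sqr_ge0 //; lra.
have -> : t ^+ 2 * (4 * t) = 4 * t ^+ 3 by ring.
have : t ^+ 3 <= (3 / 5) ^+ 3 by rewrite lerXn2r ?nnegrE ; lra.
by lra.
Qed.

(** For theta >= 1/2 the quadratic increases from v = 2 sqrt theta on, where it is already positive;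
    its real roots lie below the values of theta y + 1 / y for y > 0. *)
Lemma no_reciprocal_root theta v : 1 / 2 <= theta -> 4 * theta <= v ^+ 2 -> 0 < v ->
  theta * v ^+ 2 - v + (1 - 2 * theta ^+ 2) != 0.
Proof.
move=> th vl v0; have t0 : 0 < theta by lra.
pose t := Num.sqrt theta; have tE : theta = t ^+ 2 by rewrite sqr_sqrtr // ltW.
have tp : 0 < t by rewrite sqrtr_gt0.
have tl : 7 / 10 < t by nra.
have vt : 2 * t <= v by rewrite tE in vl; nra.
rewrite gt_eqF //.
have -> : theta * v ^+ 2 - v + (1 - 2 * theta ^+ 2) = 2 * t ^+ 4 - 2 * t + 1
  + (v - 2 * t) * (t ^+ 2 * (v + 2 * t) - 1) by rewrite tE; ring.
rewrite ltr_wpDr ?quartic_critical // mulr_ge0 ?subr_ge0 //.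
have : theta * (14 / 5) <= t ^+ 2 * (v + 2 * t) by rewrite tE ler_wpM2l ?sqr_ge0 //; lra.
by lra.
Qed.


(** The second equation after the substitution x = theta y^2. *)
Definition reciprocal_quartic theta y :=
  theta ^+ 3 * y ^+ 4 - theta * y ^+ 3 + y ^+ 2 - y + theta.

(* The quartic is invariant, up to a factor, under y -> 1 / (theta y), hence
   reduces to a quadratic in the invariant v = theta y + 1 / y. *)
Lemma reciprocal_quarticE theta y : y != 0 ->
  reciprocal_quartic theta y = y ^+ 2 *
   (theta * (theta * y + y^-1) ^+ 2 - (theta * y + y^-1) + (1 - 2 * theta ^+ 2)).
Proof. by move=> y0; rewrite /reciprocal_quartic; field. Qed.

Lemma reciprocal_sum theta v y : y != 0 ->
  (theta * y + y^-1 == v) = (theta * y ^+ 2 + - v * y + 1 == 0).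
Proof.
move=> y0; have -> : theta * y ^+ 2 + - v * y + 1 = (theta * y + y^-1 - v) * y by field.
by rewrite mulf_eq0 (negbTE y0) orbF subr_eq0.
Qed.

Lemma reciprocal_sum_roots theta v : 0 < theta -> 0 < v -> 4 * theta < v ^+ 2 ->
  exists s, [/\ uniq s, size s = 2%N &
   forall y, (y \in s) = (0 < y) && (theta * y + y^-1 == v)].
Proof.
move=> t0 v0 vt.
have [s [us sP [_ _ s2]]] := quadratic_roots (- v) 1 (lt0r_neq0 t0).
exists s; split=> //; first by apply: s2; lra.
move=> y; rewrite sP; have [y0|y0] := ltP 0 y.
  by rewrite reciprocal_sum ?lt0r_neq0.
rewrite gt_eqF //; have : 0 <= theta * y ^+ 2 by rewrite mulr_ge0 ?sqr_ge0 // ltW.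
by nra.
Qed.

(** Below [theta0'] each of the two roots v of the quadratic yields two values of y, and distinct v
    yield disjoint pairs. At [theta0'] the two v coincide; above it, none is attained at a positive
    y. *)
Lemma reciprocal_quartic_roots theta : 0 < theta ->
  exists s, [/\ uniq s,
    forall y, (y \in s) = (0 < y) && (reciprocal_quartic theta y == 0) &
    [/\ theta0' < theta -> size s = 0%N, theta = theta0' -> size s = 2%N &
        theta < theta0' -> size s = 4%N]].
Proof.
move=> t0.
have [w [uw wP [w0 w1 w2]]] := quadratic_roots (- 1) (1 - 2 * theta ^+ 2) (lt0r_neq0 t0).
have discE : (- 1) ^+ 2 - 4 * theta * (1 - 2 * theta ^+ 2) = reciprocal_disc theta.
  by rewrite /reciprocal_disc; ring.
rewrite discE in w0 w1 w2.
have quarticE y : 0 < y -> (reciprocal_quartic theta y == 0) = (theta * y + y^-1 \in w).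
  move=> /lt0r_neq0 y0; rewrite reciprocal_quarticE // mulf_eq0 sqrf_eq0 (negbTE y0).
  by rewrite wP mulN1r.
have wroot v : theta <= theta0' -> v \in w -> 0 < v /\ 4 * theta < v ^+ 2.
  by move=> tt; rewrite wP mulN1r => /eqP; exact: reciprocal_root.
have [lt|gt|tE] := ltgtP theta theta0'.
- have := w2 (reciprocal_disc_gt0 t0 lt).
  case: w uw wP {w0 w1 w2} quarticE wroot => [|v1 [|v2 []]] //= /andP[].
  rewrite inE => v12 _ _ quarticE wroot _.
  have [||v1p v1t] := wroot v1; [exact: ltW | by rewrite !inE eqxx |].
  have [||v2p v2t] := wroot v2; [exact: ltW | by rewrite !inE eqxx orbT |].
  have [s1 [us1 sz1 s1P]] := reciprocal_sum_roots t0 v1p v1t.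
  have [s2 [us2 sz2 s2P]] := reciprocal_sum_roots t0 v2p v2t.
  exists (s1 ++ s2); split.
  + rewrite cat_uniq us1 us2 andbT; apply/hasPn => y; rewrite s2P s1P.
    case/andP=> -> /eqP ->; rewrite /= eq_sym //.
  + move=> y; rewrite mem_cat s1P s2P; case: (ltP 0 y) => //= y0.
    by rewrite quarticE // !inE.
  + by rewrite size_cat sz1 sz2; split=> // h; move: lt; rewrite h ltxx.
- exists [::]; split=> //; last by split=> // h; move: gt; rewrite h ltxx.
  move=> y; rewrite in_nil; case: (ltP 0 y) => //= y0; rewrite quarticE //.
  (* Below 1/2 there is no real v; from 1/2 on, v >= 2 sqrt theta excludes a root. *)
  have [th|th] := ltP theta (1 / 2).
    by have := w0 (reciprocal_disc_lt0 gt th) => /size0nil ->.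
  rewrite wP mulN1r; apply/esym/negbTE/no_reciprocal_root => //.
    rewrite -subr_ge0; have -> : (theta * y + y^-1) ^+ 2 - 4 * theta = (theta * y - y^-1) ^+ 2.
      by field; rewrite lt0r_neq0.
    by rewrite sqr_ge0.
  by rewrite addr_gt0 ?mulr_gt0 ?invr_gt0.
- have disc0 : reciprocal_disc theta = 0.
    by rewrite /reciprocal_disc tE theta0'_eq subrr mulr0.
  have := w1 disc0; case: w uw wP {w0 w1 w2} quarticE wroot => [|v []] //= _ _ quarticE wroot _.
  have [||vp vt] := wroot v; [by rewrite tE | by rewrite inE |].
  have [s [us sz sP]] := reciprocal_sum_roots t0 vp vt.
  exists s; split=> //.
  by move=> y; rewrite sP; case: (ltP 0 y) => //= y0; rewrite quarticE // !inE.
Qed.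

(** * Reduction of the system to one variable and count of its solutions *)

Definition sos_system theta (z : R * R) : Prop :=
  [/\ 0 < z.1, 0 < z.2,
      z.1 = ((z.1 + theta * z.2) / (theta * z.2 + 1)) ^+ 2 &
      z.2 = ((theta * z.1 + z.2 + theta) / (theta * z.2 + 1)) ^+ 2].

(** Both right-hand sides are squares of positive quantities, so the square roots x and y satisfy
    the equations without the squares. The first then factors, and each of its two values of x turns
    the second into an equation in y. *)
Lemma sos_system_sqrt theta (z : R * R) : 0 < theta ->
  sos_system theta z <-> exists x y, [/\ z = (x ^+ 2, y ^+ 2), 0 < x, 0 < y &
    (x == 1) && (theta * y ^+ 3 - y ^+ 2 + y - 2 * theta == 0) ||
    (x == theta * y ^+ 2) && (reciprocal_quartic theta y == 0)].
Proof.
move=> t0.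
have D0 y : theta * y ^+ 2 + 1 != 0.
  by rewrite gt_eqF // ltr_wpDl // mulr_ge0 ?sqr_ge0 // ltW.
have red x y : 0 < x -> 0 < y ->
  (x = (x ^+ 2 + theta * y ^+ 2) / (theta * y ^+ 2 + 1) /\
   y = (theta * x ^+ 2 + y ^+ 2 + theta) / (theta * y ^+ 2 + 1)) <->
  (x == 1) && (theta * y ^+ 3 - y ^+ 2 + y - 2 * theta == 0) ||
    (x == theta * y ^+ 2) && (reciprocal_quartic theta y == 0).
  move=> x0 y0.
  have e1 : (x == (x ^+ 2 + theta * y ^+ 2) / (theta * y ^+ 2 + 1)) =
      (x == 1) || (x == theta * y ^+ 2).
    rewrite -(inj_eq (mulIf (D0 y))) divfK // -subr_eq0 -[x == 1]subr_eq0.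
    rewrite -[x == theta * _]subr_eq0 -mulf_eq0 -oppr_eq0; congr (_ == 0); ring.
  have e2 : (y == (theta * x ^+ 2 + y ^+ 2 + theta) / (theta * y ^+ 2 + 1)) =
      (y * (theta * y ^+ 2 + 1) - (theta * x ^+ 2 + y ^+ 2 + theta) == 0).
    by rewrite -(inj_eq (mulIf (D0 y))) divfK // -subr_eq0.
  have -> : (x = (x ^+ 2 + theta * y ^+ 2) / (theta * y ^+ 2 + 1) /\
    y = (theta * x ^+ 2 + y ^+ 2 + theta) / (theta * y ^+ 2 + 1)) <->
    (x == (x ^+ 2 + theta * y ^+ 2) / (theta * y ^+ 2 + 1)) &&
    (y == (theta * x ^+ 2 + y ^+ 2 + theta) / (theta * y ^+ 2 + 1)).
    by split=> [[<- <-]|/andP[/eqP ? /eqP ?]] //; rewrite !eqxx.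
  rewrite e1 e2 andb_orl.
  suff -> : (x == 1) && (y * (theta * y ^+ 2 + 1) - (theta * x ^+ 2 + y ^+ 2 + theta) == 0)
     = (x == 1) && (theta * y ^+ 3 - y ^+ 2 + y - 2 * theta == 0).
    suff -> : (x == theta * y ^+ 2) &&
        (y * (theta * y ^+ 2 + 1) - (theta * x ^+ 2 + y ^+ 2 + theta) == 0)
      = (x == theta * y ^+ 2) && (reciprocal_quartic theta y == 0) by [].
    have [->|] //= := eqVneq x (theta * y ^+ 2).
    by rewrite -oppr_eq0 /reciprocal_quartic; congr (_ == 0); ring.
  have [->|] //= := eqVneq x 1.
  by congr (_ == 0); ring.
have sqr_eq a b c : 0 < a -> 0 < b -> 0 < c -> a ^+ 2 = (b / c) ^+ 2 <-> a = b / c.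
  move=> a0 b0 c0; split=> [|-> //] /eqP.
  by rewrite eqrXn2 ?ltW ?divr_gt0 // => /eqP.
have aux x y : 0 < x -> 0 < y -> sos_system theta (x ^+ 2, y ^+ 2) <->
   (x = (x ^+ 2 + theta * y ^+ 2) / (theta * y ^+ 2 + 1) /\
   y = (theta * x ^+ 2 + y ^+ 2 + theta) / (theta * y ^+ 2 + 1)).
  move=> x0 y0; have [x2 y2] : 0 < x ^+ 2 /\ 0 < y ^+ 2 by rewrite !exprn_gt0.
  have y2t : 0 < theta * y ^+ 2 by rewrite mulr_gt0.
  have x2t : 0 < theta * x ^+ 2 by rewrite mulr_gt0.
  split=> [[_ _ /= /sqr_eq e1 /sqr_eq e2]|[e1 e2]].
    by split; [apply: e1 | apply: e2]; rewrite ?addr_gt0 // ltr_wpDl // ltW.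
  by split=> //=; [rewrite -e1 | rewrite -e2].
split=> [h|[x [y [-> x0 y0 e]]]]; last by apply/aux => //; apply/red.
have [z1 z2 _ _] := h.
have zE : z = (Num.sqrt z.1 ^+ 2, Num.sqrt z.2 ^+ 2).
  by rewrite !sqr_sqrtr ?ltW //; case: (z).
have [x0 y0] : 0 < Num.sqrt z.1 /\ 0 < Num.sqrt z.2 by rewrite !sqrtr_gt0.
exists (Num.sqrt z.1), (Num.sqrt z.2); split=> //.
by apply/red => //; apply/aux => //; rewrite -zE.
Qed.

(** The cubic contributes 1, 2 or 3 solutions and the quartic 0, 2 or 4. As theta0 < [theta0'], the
    totals are 1 + 0, 1 + 2, 1 + 4, 2 + 4 and 3 + 4 as theta decreases. *)
Theorem sos_system_count : exists theta0, `|theta0 - 135 / 1000| < 5 / 10000 /\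
  forall theta, 0 < theta -> exists s : seq (R * R),
    [/\ uniq s, forall z, z \in s <-> sos_system theta z &
    [/\ theta0' < theta -> size s = 1%N,
        theta = theta0' -> size s = 3%N,
        theta0 < theta < theta0' -> size s = 5%N,
        theta = theta0 -> size s = 6%N &
        theta < theta0 -> size s = 7%N]].
Proof.
have [theta0 [th0 d0 dgt dlt]] := critical_theta0.
have lt0 : theta0 < theta0'.
  by have := theta0'_approx; move: th0; rewrite !ltr_norml => /andP[_ h] /andP[h' _]; lra.
exists theta0; split=> // theta t0.
have [s [us sP [s1 s2 s3]]] := cubic_roots t0.
have [w [uw wP [w1 w2 w3]]] := reciprocal_quartic_roots t0.
pose f y := (1, y ^+ 2) : R * R.
pose g y := ((theta * y ^+ 2) ^+ 2, y ^+ 2) : R * R.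
have spos y : y \in s -> 0 < y by rewrite sP => /eqP; exact: cubic_root_gt0.
have wpos y : y \in w -> 0 < y by rewrite wP => /andP[].
have sqinj x y : 0 < x -> 0 < y -> x ^+ 2 = y ^+ 2 -> x = y.
  by move=> x0 y0 /eqP; rewrite eqrXn2 ?ltW // => /eqP.
exists (map f s ++ map g w); split.
- rewrite cat_uniq !map_inj_in_uniq ?us ?uw ?andbT /=; last 2 first.
  + by move=> x y xs ys /(congr1 snd) /=; apply: sqinj; exact: wpos.
  + by move=> x y xs ys /(congr1 snd) /=; apply: sqinj; exact: spos.
  apply/hasPn => _ /mapP[y yw ->]; apply/mapP => -[x xs [e1 /esym e2]].
  have xy := sqinj _ _ (spos _ xs) (wpos _ yw) e2.
  have ty : theta = (y ^+ 2)^-1.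
    apply/eqP; rewrite -(inj_eq (mulIf (lt0r_neq0 (exprn_gt0 2 (wpos _ yw))))).
    rewrite mulVf ?lt0r_neq0 ?exprn_gt0 ?wpos //; apply/eqP/sqinj => //.
      by rewrite mulr_gt0 // exprn_gt0 // wpos.
    by rewrite expr1n e1.
  (* A common solution has theta y^2 = 1, the fixed point of y -> 1 / (theta y); there the quartic
     is y^2 times the positive value of [quartic_critical] at 1 / y. *)
  have := quartic_critical y^-1.
  have -> : 2 * y^-1 ^+ 4 - 2 * y^-1 + 1 = (y ^+ 2)^-1 * reciprocal_quartic theta y.
    by rewrite /reciprocal_quartic ty; field; rewrite lt0r_neq0 // wpos.
  by move: yw; rewrite wP => /andP[_ /eqP ->]; rewrite mulr0 ltxx.
- move=> z; rewrite mem_cat; split.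
    case/orP=> /mapP[y yin ->]; apply/sos_system_sqrt => //.
      exists 1, y; rewrite expr1n ltr01 spos // eqxx; split=> //.
      by move: yin; rewrite sP => ->.
    have y0 := wpos _ yin.
    exists (theta * y ^+ 2), y; rewrite mulr_gt0 ?exprn_gt0 // y0 eqxx; split=> //.
    by move: yin; rewrite wP => /andP[_ ->]; rewrite orbT.
  move=> /(sos_system_sqrt _ t0)[x [y [-> x0 y0]]].
  case/orP=> /andP[/eqP -> h]; apply/orP; [left | right].
    by rewrite expr1n; apply/mapP; exists y => //; rewrite sP.
  by apply/mapP; exists y => //; rewrite wP y0.
rewrite size_cat !size_map; split.
- by move=> h; rewrite w1 // s1 //; apply: dlt; exact: lt_trans h.
- by move=> h; rewrite w2 // s1 //; apply: dlt; rewrite h.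
- by move=> /andP[h1 h2]; rewrite w3 // s1 //; apply: dlt.
- by move=> h; rewrite w3 ?h // s2 // h.
- by move=> h; rewrite w3 ?s3 //; [exact: dgt | exact: lt_trans lt0].
Qed.

End Solutions.

(** * The rooted tree *)

Section RootedTree.
Context {k : nat} (T : cayley_tree k).
Local Notation o := (tree_root T).
Local Notation depth := (dist o).
Implicit Types (x y : T) (p q : seq T) (n : nat).

Definition simple_path x p := [/\ path (adj T) o p, last o p = x & uniq (o :: p)].

Lemma simple_path_inj x p q : simple_path x p -> simple_path x q -> p = q.
Proof. by have [r [_ ru]] := tree_path o x; move=> /ru <- /ru <-. Qed.

(** A shortest walk can be cut down to a simple path, which by uniqueness is [p]. *)
Lemma depth_simple_path x p : simple_path x p -> depth x = size p.
Proof.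
move=> sp; have [pp lp up] := sp; rewrite /dist; case: ex_minnP => m /asboolP[q [pq lq <-]] mmin.
apply/eqP; rewrite eqn_leq mmin ?andTb; last by apply/asboolP; exists p.
move: lq; case/shortenP: pq => q' pq' uq' subq lq.
rewrite -(simple_path_inj (And3 pq' lq uq') sp) uniq_leq_size //.
by case/andP: uq'.
Qed.

Lemma simple_path_exists x : exists p, simple_path x p.
Proof. by have [p [sp _]] := tree_path o x; exists p. Qed.

(** If y is off the simple path to x, appending y gives the one to y. Otherwise the initial segment
    up to y is the simple path to y, and appending x to it keeps it simple. *)
Lemma simple_path_adj x y p q : simple_path x p -> simple_path y q -> adj T x y ->
  q = rcons p y \/ p = rcons q x.
Proof.
move=> sx sy axy; have [yp|yp] := boolP (y \in o :: p); last first.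
  left; apply: simple_path_inj sy _; have [pp lp up] := sx.
  split; first by rewrite rcons_path pp lp axy.
    by rewrite last_rcons.
  by rewrite -rcons_cons rcons_uniq yp up.
right; case/splitPl: yp sx => p1 p2 ly sx; have [] := sx.
rewrite cat_path last_cat ly -cat_cons cat_uniq => /andP[pp1 pp2] lx /and3P[u1 /hasPn u12 _].
have -> : q = p1 by exact: (simple_path_inj sy).
apply: simple_path_inj sx _; split.
- by rewrite rcons_path pp1 ly adj_sym.
- by rewrite last_rcons.
- rewrite -rcons_cons rcons_uniq u1 andbT; apply: u12.
  by case: p2 lx {pp2} => [|a p2] /= lx; [move: axy; rewrite -lx adj_irr | rewrite -lx mem_last].
Qed.

Lemma depth_root : depth o = 0%N.
Proof. by rewrite (@depth_simple_path _ [::]). Qed.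

Lemma depth_eq0 x : (depth x == 0%N) = (x == o).
Proof.
apply/eqP/eqP => [|->]; last exact: depth_root.
by have [p sp] := simple_path_exists x; rewrite (depth_simple_path sp); case: p sp => // -[].
Qed.

Lemma adj_depth x y : adj T x y -> depth y = (depth x).+1 \/ depth x = (depth y).+1.
Proof.
have [p sp] := simple_path_exists x; have [q sq] := simple_path_exists y.
rewrite (depth_simple_path sp) (depth_simple_path sq) => /(simple_path_adj sp sq).
by case=> ->; rewrite size_rcons; [left | right].
Qed.

(** The default value makes the root its own parent. *)
Definition parent y : T := xget o [set x | adj T x y /\ depth y = (depth x).+1]%classic.

Lemma parentP y : y != o -> adj T (parent y) y /\ depth y = (depth (parent y)).+1.
Proof.
rewrite /parent; case: xgetP => [x _ //|noparent] yo; exfalso.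
have [q] := simple_path_exists y; case/lastP: q => [[_ /= e]|q z sq].
  by move: yo; rewrite e eqxx.
have [] := sq; rewrite rcons_path last_rcons -rcons_cons rcons_uniq.
move=> /andP[pq az] zy /andP[_ uq]; subst z.
apply: (noparent (last o q)); split=> //.
by rewrite (depth_simple_path sq) size_rcons (@depth_simple_path _ q).
Qed.

(** Every neighbour of y closer to the root is the last but one vertex on the unique simple path to
    y. *)
Lemma parent_unique x y : adj T x y -> (depth x < depth y)%N -> x = parent y.
Proof.
move=> axy lt; have yo : y != o by rewrite -depth_eq0 -lt0n (leq_ltn_trans _ lt).
have [ay dy] := parentP yo.
have [q sq] := simple_path_exists y.
have aux z : adj T z y -> (depth z < depth y)%N -> exists2 p, simple_path z p & q = rcons p y.
  have [p sp] := simple_path_exists z => azy ltz; exists p => //.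
  have [//|pE] := simple_path_adj sp sq azy; move: ltz.
  by rewrite (depth_simple_path sp) (depth_simple_path sq) pE size_rcons ltnNge leqnSn.
have [p [_ <- _] qE] := aux _ axy lt.
have [p' [_ <- _]] : exists2 p, simple_path (parent y) p & q = rcons p y.
  by apply: aux => //; rewrite dy.
by rewrite qE => /rcons_inj[->].
Qed.

(** Off the root, one of the k + 1 neighbours is the parent and the others lie one level deeper. The
    root itself has k + 1 children. *)
Lemma children x : x != o ->
  exists s, [/\ uniq s, size s = k & forall y, (y \in s) = (y != o) && (parent y == x)].
Proof.
move=> xo; have [nb [unb szb nbP]] := adj_degree x; have [ax dx] := parentP xo.
exists (rem (parent x) nb); split; first exact: rem_uniq.
  by rewrite size_rem ?szb // -nbP adj_sym.
move=> y; rewrite mem_rem_uniq // inE -nbP; apply/andP/andP => -[].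
  move=> yx axy; have dxy : depth y = (depth x).+1.
    have [//|dxy] := adj_depth axy; case/eqP: yx; apply: parent_unique; first by rewrite adj_sym.
    by rewrite dxy.
  split; first by rewrite -depth_eq0 dxy.
  by rewrite eq_sym; apply/eqP/parent_unique => //; rewrite dxy.
move=> yo /eqP xE; have [ay dy] := parentP yo; split; last by rewrite -xE.
apply/eqP => yE; move: dx; rewrite -yE dy xE => /eqP.
by rewrite ltn_eqF // ltnS leqnSn.
Qed.

Lemma mem_Vn n x : (x \in Vn T n) = (depth x <= n)%N.
Proof.
rewrite /Vn in_fset_set; last exact: finite_Vn.
by apply/idP/idP => [/set_mem|xn] //; apply/mem_set.
Qed.

Lemma root_neighbor : exists x, depth x = 1%N.
Proof.
have [nb [_ szb nbP]] := adj_degree o; case: nb szb nbP => // x nb _ /(_ x).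
rewrite inE eqxx => aox; exists x; have [] := adj_depth aox; rewrite depth_root //.
Qed.

End RootedTree.

(** * Weights and compatibility *)

Section Weights.
Context {k : nat} (T : cayley_tree k) {R : realType} (theta : R).
Local Notation o := (tree_root T).
Local Notation depth := (dist o).
Local Notation V := (Vn T).
Implicit Types (x y : T) (n : nat) (c : 'I_3 -> R) (u : T -> 'I_3).

(** Spins outside A are set to 0, so that products can run over vertices of the tree instead of
    elements of a finite subtype. *)
Definition totalize (A : {fset T}) (s : conf A) : T -> 'I_3 :=
  fun x => if insub x is Some a then s a else ord0.

Lemma totalizeE (A : {fset T}) (s : conf A) (a : A) : totalize s (val a) = s a.
Proof. by rewrite /totalize valK. Qed.

Definition restriction (A B : {fset T}) (t : conf B) : conf A :=
  [ffun a : A => totalize t (val a)].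

Lemma totalize_restriction (A B : {fset T}) (t : conf B) x :
  x \in A -> totalize (restriction A t) x = totalize t x.
Proof. by move=> xA; rewrite -[x]/(val [` xA]%fset) totalizeE ffunE. Qed.

Lemma extendsE (A B : {fset T}) (s : conf A) (t : conf B) : (A `<=` B)%fset ->
  extends s t = (restriction A t == s).
Proof.
move=> /fsubsetP AB; apply/idP/eqP => [/forallP h|<-].
  apply/ffunP => a; rewrite ffunE; have aB := AB _ (valP a).
  have /forallP/(_ [` aB]%fset) := h a; rewrite /= eqxx => /eqP ->.
  by rewrite -totalizeE.
apply/forallP => a; apply/forallP => b; apply/implyP => /eqP ab.
by rewrite ffunE ab totalizeE.
Qed.

Lemma sub_Vn m n : (m <= n)%N -> (V m `<=` V n)%fset.
Proof. by move=> mn; apply/fsubsetP => x; rewrite !mem_Vn => /leq_trans; apply. Qed.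

(** Each edge is indexed by its endpoint farther from the root. *)
Definition edges n u : R :=
  \prod_(y <- V n | y != o) activity theta (u (parent y)) (u y).

Definition sphere n (f : T -> R) : R := \prod_(y <- V n | depth y == n) f y.

Lemma parent_Vn n y : y \in V n -> parent y \in V n.
Proof.
rewrite !mem_Vn; have [->|yo] := eqVneq y o; last first.
  by have [_ ->] := parentP yo; exact: ltnW.
rewrite /parent; case: xgetP => [x _ [_]|]; last by rewrite depth_root.
by rewrite depth_root.
Qed.

Lemma weightE c n (s : conf (V n)) :
  weight theta (fun=> c) s = edges n (totalize s) * sphere n (fun x => c (totalize s x)).
Proof.
rewrite /weight /edges /sphere; congr (_ * _); last first.
  by rewrite [RHS]big_seq_fsetE; apply: eq_bigr => x _; rewrite totalizeE.
rewrite [RHS]big_seq_fsetE /=.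
pose Q (x y : V n) := adj T (val x) (val y) && (depth (val x) < depth (val y))%N.
rewrite -(@pair_big_dep _ _ _ _ _ xpredT Q (fun a b : V n => activity theta (s a) (s b))) /=.
rewrite (exchange_big_dep (fun y : V n => val y != o)) /=; last first.
  by move=> a b _ /andP[_ lt]; rewrite -depth_eq0 -lt0n (leq_ltn_trans _ lt).
apply: eq_bigr => y yo; have pV := parent_Vn (valP y).
rewrite (big_pred1 [` pV]%fset) => [|x]; first by rewrite !totalizeE -(totalizeE s [` pV]%fset).
apply/andP/eqP => [[a l]|->] /=; first by apply/val_inj; exact: parent_unique.
by have [ay ->] := parentP yo.
Qed.

Lemma sphereM n (f g : T -> R) : sphere n (fun x => f x * g x) = sphere n f * sphere n g.
Proof. exact: big_split. Qed.

Lemma sphere_const n (a : R) : sphere n (fun=> a) = a ^+ count (fun y => depth y == n) (V n).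
Proof. by rewrite /sphere big_const_seq iter_mulr_1. Qed.

Lemma eq_sphere n (f g : T -> R) : (forall x, depth x = n -> f x = g x) ->
  sphere n f = sphere n g.
Proof. by move=> fg; apply: eq_bigr => x /eqP; exact: fg. Qed.

Lemma Vn_succ_perm n : perm_eq [seq y <- V n.+1 | (depth y <= n)%N] (V n).
Proof.
apply: uniq_perm; rewrite ?filter_uniq ?fset_uniq // => y.
by rewrite mem_filter !mem_Vn; case: leqP => //= h; rewrite leqW.
Qed.

(** The vertices of the sphere n + 1, grouped by parent, form groups of size k, since 0 < n keeps
    the root from being one of these parents. *)
Lemma sphere_parent n (f : T -> R) : (0 < n)%N ->
  sphere n.+1 (fun y => f (parent y)) = sphere n (fun x => f x ^+ k).
Proof.
move=> n0; have oV : o \in V n by rewrite mem_Vn depth_root.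
pose p y : V n := odflt [` oV]%fset (insub (parent y)).
have pE y : depth y = n.+1 -> val (p y) = parent y.
  move=> dy; have yo : y != o by rewrite -depth_eq0 dy.
  have [_] := parentP yo; rewrite dy => -[dp].
  by rewrite /p insubT ?mem_Vn -?dp.
rewrite /sphere (@partition_big _ _ _ _ _ _ _ p (fun a : V n => depth (val a) == n)); last first.
  move=> y /eqP dy; rewrite pE //; have yo : y != o by rewrite -depth_eq0 dy.
  by have [_] := parentP yo; rewrite dy => -[->].
rewrite [RHS]big_seq_fsetE; apply: eq_bigr => x /eqP dx /=.
have [s [us sz sP]] : exists s, [/\ uniq s, size s = k &
    forall y, (y \in s) = (y != o) && (parent y == val x)].
  by apply: children; rewrite -depth_eq0 dx -lt0n.
rewrite -big_filter (perm_big s) /=; last first.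
  apply: uniq_perm; rewrite ?filter_uniq ?fset_uniq // => y.
  rewrite mem_filter sP mem_Vn; apply/idP/idP.
    move=> /andP[/andP[/eqP dy /eqP <-] _]; rewrite -depth_eq0 dy /=.
    by rewrite pE.
  move=> /andP[yo /eqP pyE]; have [_] := parentP yo; rewrite pyE dx => dy.
  by rewrite dy eqxx leqnn andbT /=; apply/eqP/val_inj; rewrite pE.
rewrite big_seq (eq_bigr (fun=> f (val x))) => [|y]; last first.
  by rewrite sP => /andP[_ /eqP ->].
by rewrite -big_seq big_const_seq count_predT iter_mulr_1 sz.
Qed.

Definition local_field c (i : 'I_3) : R := \sum_j activity theta i j * c j.

(* Given the configuration on the ball, the spins of the next sphere are
   independent, and a parent at positive depth has exactly k children. *)
Lemma sum_extensions c n (s : conf (V n)) : (0 < n)%N ->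
  \sum_(t : conf (V n.+1) | extends s t) weight theta (fun=> c) t =
  edges n (totalize s) * sphere n (fun x => local_field c (totalize s x) ^+ k).
Proof.
move=> n0.
(* Edge factors read the parent's spin from [s], since the parent of every vertex of the larger ball
   lies in the ball of radius n. *)
pose e y j := if y == o then 1 else activity theta (totalize s (parent y)) j.
pose G (y : V n.+1) j := e (val y) j * (if depth (val y) == n.+1 then c j else 1).
pose Q (y : V n.+1) := [pred j | (depth (val y) <= n)%N ==> (j == totalize s (val y))].
(* Distributivity: [Q] fixes the spins inside the ball of radius n and leaves those on the next
   sphere free, so the sum over extensions becomes a product over vertices of sums over spins. *)
transitivity (\prod_y \sum_(j | Q y j) G y j).
  rewrite bigA_distr_big_dep; apply: eq_big => [t|t].
    rewrite extendsE ?sub_Vn //; apply/eqP/familyP => [sE y|tQ].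
      rewrite inE; apply/implyP => yn; rewrite -sE totalize_restriction ?mem_Vn //.
      by rewrite totalizeE.
    apply/ffunP => x; rewrite ffunE; have xV : val x \in V n.+1.
      exact: (fsubsetP (sub_Vn (leqnSn n))) (valP x).
    have := tQ [` xV]%fset; rewrite inE /= -mem_Vn (valP x) /= => /eqP.
    by rewrite totalizeE => <-; rewrite -totalizeE.
  rewrite extendsE ?sub_Vn // => /eqP sE; rewrite weightE /edges /sphere.
  rewrite big_mkcond [X in _ * X]big_mkcond -big_split big_seq_fsetE /=.
  apply: eq_bigr => y _; rewrite /G /e; congr (_ * _); last by rewrite totalizeE.
  case: eqVneq => //= yo; rewrite totalizeE -sE totalize_restriction //.
  have [_] := parentP yo; rewrite mem_Vn -ltnS => <-.
  by rewrite -mem_Vn; exact: valP.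
pose H y := \sum_(j | (depth y <= n)%N ==> (j == totalize s y))
   e y j * (if depth y == n.+1 then c j else 1).
rewrite -(big_seq_fsetE _ _ predT H) /= (bigID (fun y => (depth y <= n)%N)) /=.
congr (_ * _).
  rewrite -big_filter (perm_big _ (Vn_succ_perm n)) /edges [RHS]big_mkcond /=.
  rewrite big_seq [RHS]big_seq; apply: eq_bigr => y; rewrite mem_Vn => yn.
  rewrite /H yn /= big_pred1_eq /e ltn_eqF ?ltnS // mulr1.
  by case: eqP.
rewrite -(sphere_parent (fun x => local_field c (totalize s x))) // /sphere.
rewrite big_seq_cond [RHS]big_seq_cond; apply: eq_big => [y|y].
  by rewrite mem_Vn -ltnNge; case: (ltngtP (depth y) n.+1).
rewrite mem_Vn -ltnNge => /andP[l1 l2].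
have dy : depth y = n.+1 by apply/eqP; rewrite eqn_leq l1.
rewrite /H dy ltnn eqxx /=; apply: eq_bigr => j _; rewrite /e.
by rewrite -depth_eq0 dy.
Qed.

End Weights.

(** * Compatibility and the fixed point system *)

Section Compatibility.
Context {k : nat} (T : cayley_tree k) {R : realType} (theta : R).
Local Notation o := (tree_root T).
Local Notation depth := (dist o).
Local Notation V := (Vn T).
Implicit Types (x y : T) (n : nat) (i j : 'I_3).

Lemma activity_forbidden i j : ~~ allowed i j -> activity theta i j = 0.
Proof.
rewrite /allowed /activity; case: eqVneq => [->|_]; first by rewrite subrr normr0.
by case: eqP => // ->; rewrite lexx.
Qed.

Lemma weight_forbidden z n (s : conf (V n)) : s \notin Omega_fin (V n) ->
  weight theta z s = 0.
Proof.
rewrite inE negb_forall => /existsP[x]; rewrite negb_forall => /existsP[y].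
rewrite negb_imply => /andP[axy sxy].
have aux a b : adj T (val a) (val b) -> (depth (val a) < depth (val b))%N ->
    ~~ allowed (s a) (s b) -> weight theta z s = 0.
  move=> aab lab sab; rewrite /weight (bigD1 (a, b)) /=; last by rewrite aab.
  by rewrite activity_forbidden // !mul0r.
have [dy|dx] := adj_depth axy; first by apply: aux sxy => //; rewrite dy.
apply: (aux y x); [by rewrite adj_sym | by rewrite dx |].
by move: sxy; rewrite /allowed distrC.
Qed.

(** Inadmissible configurations have weight zero; including them gives the sums over full function
    spaces to which distributivity applies. *)
Lemma sum_weight_forbidden z n (P : pred (conf (V n))) :
  \sum_(s in Omega_fin (V n) | P s) weight theta z s = \sum_(s | P s) weight theta z s.
Proof.
rewrite big_mkcondl /=; apply: eq_bigr => s _.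
by case: ifPn => // /weight_forbidden ->.
Qed.

Lemma restriction_admissible m n (t : conf (V n)) : (m <= n)%N ->
  t \in Omega_fin (V n) -> restriction (V m) t \in Omega_fin (V m).
Proof.
move=> mn; rewrite !inE => /forallP h; apply/forallP => x; apply/forallP => y.
apply/implyP => axy; rewrite !ffunE.
have sub a : a \in V m -> a \in V n by exact: (fsubsetP (sub_Vn T mn)).
have /forallP/(_ [` sub _ (valP y)]%fset)/implyP/(_ axy) := h [` sub _ (valP x)]%fset.
by rewrite -!totalizeE.
Qed.

Lemma const_conf_admissible n i : [ffun=> i] \in Omega_fin (V n).
Proof.
rewrite inE; apply/forallP => x; apply/forallP => y; apply/implyP => _.
by rewrite !ffunE /allowed subrr normr0.
Qed.

Hypothesis theta_gt0 : 0 < theta.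

Lemma activity_ge0 i j : 0 <= activity theta i j.
Proof. by rewrite /activity; case: ifP => // _; case: ifP => // _; exact: ltW. Qed.

Lemma activity_diag i : activity theta i i = 1.
Proof. by rewrite /activity eqxx. Qed.

Context (c : 'I_3 -> R).
Hypothesis c_gt0 : forall i, 0 < c i.
Local Notation w := (weight theta (fun=> c)).

Lemma weight_ge0 n (s : conf (V n)) : 0 <= w s.
Proof.
rewrite /weight mulr_ge0 // prodr_ge0 // => *; first exact: activity_ge0.
exact: ltW.
Qed.

Lemma totalize_const n i x : x \in V n -> totalize ([ffun=> i] : conf (V n)) x = i.
Proof. by move=> xV; rewrite -[x]/(val [` xV]%fset) totalizeE ffunE. Qed.

Lemma edges_const n i : edges theta n (totalize ([ffun=> i] : conf (V n))) = 1.
Proof.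
rewrite /edges big_seq_cond big1 // => y /andP[yV _].
by rewrite !totalize_const ?parent_Vn // activity_diag.
Qed.

(** On a constant configuration every edge weighs 1, which isolates the boundary value c i. *)
Lemma weight_const n i :
  w ([ffun=> i] : conf (V n)) = c i ^+ count (fun y => depth y == n) (V n).
Proof.
rewrite weightE edges_const mul1r -sphere_const; apply: eq_sphere => x dx.
by rewrite totalize_const // mem_Vn dx.
Qed.

Lemma Zn_gt0 n : 0 < Zn theta (fun _ : T => c) n.
Proof.
rewrite /Zn (bigD1 [ffun=> ord0]) ?const_conf_admissible //= ltr_wpDr //.
  by apply: sumr_ge0 => s _; exact: weight_ge0.
by rewrite weight_const exprn_gt0.
Qed.

Lemma local_field_gt0 i : 0 < local_field theta c i.
Proof.
rewrite /local_field (bigD1 i) //= activity_diag mul1r ltr_wpDr //.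
by apply: sumr_ge0 => j _; rewrite mulr_ge0 ?activity_ge0 ?ltW.
Qed.

Lemma count_sphere1_gt0 : (0 < count (fun y => depth y == 1%N) (V 1))%N.
Proof.
have [x dx] := root_neighbor T; rewrite -has_count; apply/hasP.
by exists x; rewrite ?mem_Vn dx.
Qed.

(** The system with denominators cleared; its instance at [ord_max] amounts to the normalisation. *)
Definition fixed_point := forall i,
  local_field theta c i ^+ k = local_field theta c ord_max ^+ k * c i.

Lemma sum_mu_n n : \sum_(s in Omega_fin (V n)) mu_n theta (fun=> c) s = 1.
Proof. by rewrite -mulr_suml divff // gt_eqF // Zn_gt0. Qed.

(** Summing out a sphere multiplies every weight by the same constant [C], hence also the partition
    function, and [C] cancels in the quotient. *)
Lemma fixed_point_compatible : fixed_point -> compatible_seq theta (fun _ : T => c).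
Proof.
move=> fp [|[|n]] // _; set m := n.+1.
pose C := local_field theta c ord_max ^+ k ^+ count (fun y => depth y == m) (V m).
have ext (s : conf (V m)) :
    \sum_(t in Omega_fin (V m.+1) | extends s t) w t = C * w s.
  rewrite sum_weight_forbidden sum_extensions // weightE mulrCA; congr (_ * _).
  rewrite /C -sphere_const -sphereM; apply: eq_sphere => x _; exact: fp.
have ZE : Zn theta (fun _ : T => c) m.+1 = C * Zn theta (fun _ : T => c) m.
  rewrite /Zn mulr_sumr 
    (partition_big (@restriction _ T (V m) (V m.+1)) (mem (Omega_fin (V m)))) /=.
    apply: eq_bigr => s _; rewrite -ext; apply: eq_bigl => t.
    by rewrite extendsE // sub_Vn.
  by move=> t; exact: restriction_admissible.
have C0 : C != 0 by rewrite gt_eqF // !exprn_gt0 // local_field_gt0.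
move=> s _; rewrite /mu_n -mulr_suml ext ZE -mulf_div divff // mul1r //.
Qed.

(** At n = 2, the constant configurations i and [ord_max] on the unit ball give two equations.
    Eliminating the partition functions leaves an identity between N-th powers of positive numbers,
    N > 0 being the size of the unit sphere. *)
Lemma compatible_fixed_point : c ord_max = 1 ->
  compatible_seq theta (fun _ : T => c) -> fixed_point.
Proof.
move=> cmax /(_ 2 isT) /= comp i.
pose N := count (fun y => depth y == 1%N) (V 1).
have N0 : (0 < N)%N by exact: count_sphere1_gt0.
pose Z n := Zn theta (fun _ : T => c) n.
have Z0 n : Z n != 0 by rewrite gt_eqF // Zn_gt0.
have eqN j : (local_field theta c j ^+ k) ^+ N / Z 2 = c j ^+ N / Z 1.
  have := comp [ffun=> j] (const_conf_admissible 1 j).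
  rewrite /mu_n -mulr_suml sum_weight_forbidden sum_extensions // weight_const => <-.
  rewrite edges_const mul1r -sphere_const; congr (_ / _); apply: eq_sphere => x dx.
  by rewrite totalize_const // mem_Vn dx.
have f0 j : 0 < local_field theta c j by exact: local_field_gt0.
have : (local_field theta c i ^+ k) ^+ N = (local_field theta c ord_max ^+ k * c i) ^+ N.
  have eqN' j : (local_field theta c j ^+ k) ^+ N = c j ^+ N / Z 1 * Z 2.
    by rewrite -eqN divfK.
  by rewrite exprMn !eqN' cmax expr1n mul1r [RHS]mulrC mulrA.
move/eqP; rewrite eqrXn2 // ?mulr_ge0 ?exprn_ge0 ?ltW //.
by move/eqP.
Qed.

End Compatibility.

(** Constant configurations suffice: spin [ord_max] identifies the partition functions, then spin i
    gives equal powers of c i and c' i. *)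
Lemma mu_n_inj (k : nat) (T : cayley_tree k) (R : realType) (theta : R)
    (c c' : 'I_3 -> R) : 0 < theta ->
  (forall i, 0 < c i) -> (forall i, 0 < c' i) -> c ord_max = 1 -> c' ord_max = 1 ->
  (forall s : conf (Vn T 1), s \in Omega_fin (Vn T 1) ->
    mu_n theta (fun=> c) s = mu_n theta (fun=> c') s) ->
  forall i, c i = c' i.
Proof.
move=> t0 c0 c0' cm cm' h i.
pose N := count (fun y => dist (tree_root T) y == 1%N) (Vn T 1).
pose Z := Zn theta (fun _ : T => c) 1; pose Z' := Zn theta (fun _ : T => c') 1.
have hN j : c j ^+ N / Z = c' j ^+ N / Z'.
  by have := h [ffun=> j] (const_conf_admissible T 1 j); rewrite /mu_n !weight_const.
have [Z0 Z0'] : Z != 0 /\ Z' != 0 by rewrite !gt_eqF ?Zn_gt0.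
have ZE : Z = Z'.
  by have := hN ord_max; rewrite cm cm' !expr1n !mul1r => /invr_inj.
have := hN i; rewrite ZE => /(mulIf (invr_neq0 Z0')) /eqP.
by rewrite eqrXn2 ?ltW ?count_sphere1_gt0 // => /eqP.
Qed.

(** * Nested subdivisions of the unit interval *)

Section NestedIntervals.
Local Open Scope classical_set_scope.
Local Open Scope ring_scope.
Context {R : realType}.

(** Intervals of lengths p i are laid end to end from a in the order of s; at j in s the value is
    the left end of its interval. *)
Fixpoint split_left (I : eqType) (p : I -> R) (a : R) (s : seq I) : I -> R :=
  if s is i :: s' then fun j => if j == i then a else split_left p (a + p i) s' j
  else fun=> a.

Section Split.
Context (I : eqType) (p : I -> R).
Hypothesis p0 : forall i, 0 <= p i.
Implicit Types (a u : R) (s : seq I).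

Lemma split_left_bounds a s i : i \in s ->
  a <= split_left p a s i /\ split_left p a s i + p i <= a + \sum_(j <- s) p j.
Proof.
elim: s a => // j s IH a; rewrite big_cons inE /= addrA.
case: eqVneq => [-> _|_ /= /(IH (a + p j)) [h1 h2]].
  by rewrite lexx lerDl sumr_ge0.
by split=> //; apply: le_trans h1; rewrite lerDl.
Qed.

Lemma split_left_cover a s u : uniq s -> a <= u -> u < a + \sum_(j <- s) p j ->
  exists2 i, i \in s & split_left p a s i <= u < split_left p a s i + p i.
Proof.
elim: s a => [|j s IH] a; first by rewrite big_nil addr0 ltNge => _ ->.
rewrite big_cons addrA => /andP[js us] au ub /=; have [lt|ge] := ltP u (a + p j).
  by exists j; rewrite ?inE ?eqxx // au lt.
have [i si h] := IH _ us ge ub; exists i; first by rewrite inE si orbT.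
by rewrite ifN //; apply: contraNneq js => <-.
Qed.

Lemma split_left_disjoint a s u i j : uniq s -> i \in s -> j \in s ->
  split_left p a s i <= u < split_left p a s i + p i ->
  split_left p a s j <= u < split_left p a s j + p j -> i = j.
Proof.
elim: s a => // l s IH a /= /andP[ls us]; rewrite !inE.
have far b m : m \in s -> a <= u < a + p l -> split_left p (a + p l) s m <= u < b -> i = j.
  move=> /(split_left_bounds (a + p l))[h _] /andP[_ h1] /andP[h2 _].
  by move: (le_lt_trans (le_trans h h2) h1); rewrite ltxx.
case: (eqVneq i l) => [il|_]; case: (eqVneq j l) => [jl|_] //= si sj hi hj.
- by rewrite il jl.
- by rewrite il in hi; exact: far sj hi hj.
- by rewrite jl in hj; exact: far si hj hi.
- exact: IH hi hj.
Qed.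

End Split.

Context (C : nat -> finType) (r : forall n, C n.+1 -> C n) (p : forall n, C n -> R).
Hypothesis p_ge0 : forall n s, 0 <= p (n := n) s.
Hypothesis p_sum0 : \sum_s p (n := 0) s = 1.
Hypothesis p_sumS : forall n s, \sum_(t | r t == s) p t = p (n := n) s.

(** All t with a common restriction subdivide the cell of that restriction, from its left end on. *)
Fixpoint left_end n : C n -> R :=
  if n is n'.+1 then fun t => split_left (@p n'.+1) (left_end (r t))
    [seq t' <- enum (C n'.+1) | r t' == r t] t
  else split_left (@p 0) 0 (enum (C 0)).

Definition in_cell n (s : C n) u := left_end s <= u < left_end s + p s.

(** By [p_sumS] the siblings of t have total length p (r t), so their cells stay inside that of r
    t. *)
Lemma left_endS n (t : C n.+1) :
  left_end (r t) <= left_end t /\ left_end t + p t <= left_end (r t) + p (r t).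
Proof.
have := @split_left_bounds _ _ (p_ge0 (n := n.+1)) (left_end (r t))
   [seq t' <- enum (C n.+1) | r t' == r t] t.
by rewrite mem_filter eqxx mem_enum big_filter big_enum_cond /= p_sumS => /(_ isT).
Qed.

Lemma in_cellS n (t : C n.+1) u : in_cell t u -> in_cell (r t) u.
Proof.
have [h1 h2] := left_endS t; move=> /andP[h3 h4]; apply/andP; split.
  exact: le_trans h3.
exact: lt_le_trans h2.
Qed.

Lemma in_cell01 n (s : C n) : 0 <= left_end s /\ left_end s + p s <= 1.
Proof.
elim: n s => [|n IH] s.
  have := @split_left_bounds _ _ (p_ge0 (n := 0)) 0 (enum (C 0)) s.
  by rewrite mem_enum big_enum /= p_sum0 add0r => /(_ isT).
have [h1 h2] := left_endS s; have [h3 h4] := IH (r s).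
by split; [exact: le_trans h1 | exact: le_trans h4].
Qed.

Lemma in_cell_exists n u : 0 <= u < 1 -> exists s : C n, in_cell s u.
Proof.
move=> u01; have /andP[u0 u1] := u01; elim: n => [|n [s /andP[h1 h2]]].
  have [|s _ h] := @split_left_cover _ (@p 0) 0 (enum (C 0)) u (enum_uniq _) u0.
    by rewrite big_enum /= p_sum0 add0r.
  by exists s.
have [||t] := @split_left_cover _ (@p n.+1) (left_end s)
   [seq t' <- enum (C n.+1) | r t' == s] u _ h1.
- by rewrite filter_uniq ?enum_uniq.
- by rewrite big_filter big_enum_cond /= p_sumS.
by rewrite mem_filter => /andP[/eqP rt _] h; exists t; rewrite /in_cell /= rt.
Qed.

(** By induction the restrictions agree, so s and s' belong to the same subdivision, whose cells are
    disjoint. *)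
Lemma in_cell_inj n (s s' : C n) u : in_cell s u -> in_cell s' u -> s = s'.
Proof.
elim: n s s' => [|n IH] s s' hs hs'.
  by apply: (split_left_disjoint (p_ge0 (n := 0)) _ _ _ hs hs'); rewrite ?enum_uniq ?mem_enum.
have rs : r s = r s' by apply: IH; exact: in_cellS.
move: hs hs'; rewrite /in_cell /= -rs => hs hs'.
apply: (split_left_disjoint (p_ge0 (n := n.+1)) _ _ _ hs hs').
- by rewrite filter_uniq ?enum_uniq.
- by rewrite mem_filter eqxx mem_enum.
- by rewrite mem_filter -rs eqxx mem_enum.
Qed.

End NestedIntervals.

(** * Laws of functions under the uniform distribution on [0, 1[ *)

Section UnitInterval.
Local Open Scope classical_set_scope.
Local Open Scope ring_scope.

Lemma unit_interval_pushforward (R : realType) d (X : measurableType d) (g : R -> X) :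
  measurable_fun setT (g : measurableTypeR R -> X) ->
  exists P : probability X R, forall A, measurable A ->
    P A = lebesgue_measure (g @^-1` A `&` `[0, 1[).
Proof.
move=> mg.
pose G : {mfun measurableTypeR R >-> X} :=
  HB.pack (g : measurableTypeR R -> X) (isMeasurableFun.Build _ _ _ _ _ mg).
pose L := mrestr lebesgue_measure (measurable_itv (`[0, 1[ : interval R)).
have L1 : L setT = 1%E by rewrite /L /mrestr setTI lebesgue_measure_itv /= lte01 sube0.
pose U : probability (measurableTypeR R) R :=
  HB.pack L (Measure_isProbability.Build _ _ R L L1).
by exists (distribution U G).
Qed.

End UnitInterval.

(** * Measures on configurations *)

Section Cylinders.
Local Open Scope classical_set_scope.
Local Open Scope ring_scope.
Context {k : nat} (T : cayley_tree k).
Local Notation o := (tree_root T).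
Local Notation depth := (dist o).
Local Notation V := (Vn T).
Implicit Types (x y : T) (m n : nat) (i j : 'I_3).

Definition cylinder n (s : conf (V n)) : set (OmegaM T) :=
  [set w | restr (V n) w = s].

Lemma restrE n (w : Omega T) (s : conf (V n)) :
  restr (V n) w = s <-> forall x, x \in V n -> sval w x = totalize s x.
Proof.
split=> [<- x xV|h]; first by rewrite -[x]/(val [` xV]%fset) totalizeE ffunE.
by apply/ffunP => x; rewrite ffunE h ?totalizeE //; exact: valP.
Qed.

Lemma restr_restriction m n (w : Omega T) : (m <= n)%N ->
  restr (V m) w = restriction (V m) (restr (V n) w).
Proof.
move=> mn; apply/ffunP => x; rewrite !ffunE.
have xV : val x \in V n by exact: (fsubsetP (sub_Vn T mn)) (valP x).
by rewrite -[X in totalize _ X]/(val [` xV]%fset) totalizeE ffunE.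
Qed.

Lemma restr_admissible n (w : Omega T) : restr (V n) w \in Omega_fin (V n).
Proof.
rewrite inE; apply/forallP => x; apply/forallP => y; apply/implyP => axy.
by rewrite !ffunE; exact: (svalP w).
Qed.

Lemma evaluation_measurable x i : measurable ([set w | sval w x = i] : set (OmegaM T)).
Proof. by apply: sub_sigma_algebra; exists x, i. Qed.

Lemma cylinder_measurable n (s : conf (V n)) : measurable (cylinder s).
Proof.
have -> : cylinder s = \bigcap_(x in [set: V n]) [set w | sval w (val x) = s x].
  apply/seteqP; split=> w /=.
    by move=> ws x _ /=; rewrite -ws ffunE.
  by move=> h; apply/ffunP => x; rewrite ffunE; exact: h.
apply: fin_bigcap_measurable; first exact: finite_finset.
by move=> x _; exact: evaluation_measurable.
Qed.

Lemma evaluation_cylinders n x i : x \in V n ->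
  [set w : OmegaM T | sval w x = i] =
  \bigcup_(s in [set s : conf (V n) | totalize s x = i]) cylinder s.
Proof.
move=> xV; apply/seteqP; split=> [w wi|w [s /= si]]; last first.
  by rewrite /cylinder /= restrE => ->.
exists (restr (V n) w) => //=; rewrite -wi.
by have /restrE -> : restr (V n) w = restr (V n) w by [].
Qed.

(** Two cylinders are nested or disjoint, which makes them, with the empty set, stable under
    intersection. *)
Lemma setI_cylinder m n (s : conf (V m)) (t : conf (V n)) : (m <= n)%N ->
  cylinder s `&` cylinder t = if restriction (V m) t == s then cylinder t else set0.
Proof.
move=> mn; case: eqP => h; apply/seteqP; split=> [w [ws wt] //|w //].
  by move=> wt; split=> //; rewrite /cylinder /= (restr_restriction _ mn) wt.
by apply: h; rewrite -ws (restr_restriction _ mn) wt.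
Qed.

Lemma cylinder_inadmissible n (s : conf (V n)) : s \notin Omega_fin (V n) ->
  cylinder s = set0.
Proof.
move=> sO; apply/seteqP; split=> // w ws; move: sO.
by rewrite -ws restr_admissible.
Qed.

(** The cylinders generate the sigma-algebra and, with the empty set and the full space, form a
    pi-system, so uniqueness of extension applies. *)
Lemma same_measure_cylinders {R : realType} (mu nu : probability (OmegaM T) R) :
  (forall n, (0 < n)%N -> forall s : conf (V n), s \in Omega_fin (V n) ->
    mu (cylinder s) = nu (cylinder s)) -> same_measure mu nu.
Proof.
move=> munu A mA.
pose G : set (set (OmegaM T)) := [set B | [\/ B = set0, B = setT |
   exists n (s : conf (V n)), (0 < n)%N /\ B = cylinder s]].
apply: (measure_unique G (fun=> setT)) mA.
- apply/seteqP; split; apply: smallest_sub.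
  + exact: smallest_sigma_algebra.
  + move=> _ [x [i ->]].
    (* The hypothesis covers positive radii only, hence the maximum with 1. *)
    rewrite (@evaluation_cylinders (maxn 1 (depth x))) ?mem_Vn ?leq_maxr //.
    have fin := @finite_finset _ [set s : conf (V (maxn 1 (depth x))) | totalize s x = i].
    apply: (@fin_bigcup_measurable _ (g_sigma_algebraType G)) fin _ => s _.
    apply: sub_sigma_algebra; apply: Or33.
    by exists (maxn 1 (depth x)), s; rewrite leq_maxl.
  + exact: sigma_algebra_measurable.
  + move=> _ [->|->|[n [s [_ ->]]]]; [exact: measurable0|exact: measurableT|].
    exact: cylinder_measurable.
- move=> B D [->|->|[n [s [n0 ->]]]]; rewrite ?set0I ?setTI //; first by move=> _; exact: Or31.
  move=> [->|->|[m [t [m0 ->]]]]; rewrite ?setI0 ?setIT; [exact: Or31|by apply: Or33; exists n, s|].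
  have [nm|/ltnW mn] := leqP n m; last rewrite setIC.
    rewrite setI_cylinder //; case: ifP => _; last exact: Or31.
    by apply: Or33; exists m, t.
  rewrite setI_cylinder //; case: ifP => _; last exact: Or31.
  by apply: Or33; exists n, s.
- by move=> _; exact: Or32.
- by rewrite bigcup_const.
- move=> _ [->|->|[n [s [n0 ->]]]]; first by rewrite !measure0.
    exact: etrans (probability_setT mu) (esym (probability_setT nu)).
  have [sO|sO] := boolP (s \in Omega_fin (V n)); first exact: munu.
  by rewrite cylinder_inadmissible // !measure0.
- by move=> _; apply: fin_num_fun_lty; exact: fin_num_measure.
Qed.

End Cylinders.

(** * Realisation of compatible distributions by a measure *)

Section Existence.
Local Open Scope classical_set_scope.
Local Open Scope ring_scope.
Context {k : nat} (T : cayley_tree k) {R : realType} (theta : R) (c : 'I_3 -> R).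
Local Notation o := (tree_root T).
Local Notation depth := (dist o).
Local Notation V := (Vn T).
Hypotheses (theta_gt0 : 0 < theta) (c_gt0 : forall i, 0 < c i).
Hypothesis comp : compatible_seq theta (fun _ : T => c).
Local Notation mun := (mu_n theta (fun _ : T => c)).
Implicit Types (x y : T) (m n : nat).

Lemma mu_n_ge0 n (s : conf (V n)) : 0 <= mun s.
Proof. by rewrite /mu_n divr_ge0 ?weight_ge0 // ltW // Zn_gt0. Qed.

Lemma mu_n_forbidden n (s : conf (V n)) : s \notin Omega_fin (V n) -> mun s = 0.
Proof. by move=> sO; rewrite /mu_n weight_forbidden // mul0r. Qed.

Lemma sum_mu_n_forbidden n (P : pred (conf (V n))) :
  \sum_(s in Omega_fin (V n) | P s) mun s = \sum_(s | P s) mun s.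
Proof. by rewrite /mu_n -!mulr_suml sum_weight_forbidden. Qed.

(** Level n of the subdivision is the ball of radius n + 1, since compatibility relates balls of
    positive radius only. *)
Let p n (s : conf (V n.+1)) := mun s.
Let r n (t : conf (V n.+2)) := restriction (V n.+1) t.

Let p_ge0 n (s : conf (V n.+1)) : 0 <= p s. Proof. exact: mu_n_ge0. Qed.

Let p_sum0 : \sum_(s : conf (V 1)) p s = 1.
Proof.
rewrite -(sum_mu_n T theta_gt0 c_gt0 1) -(sum_mu_n_forbidden xpredT).
by apply: eq_bigl => s; rewrite andbT.
Qed.

(** For admissible s this is compatibility; for inadmissible s every extension is inadmissible too
    and both sides vanish. *)
Let p_sumS n (s : conf (V n.+1)) : \sum_(t | r t == s) p t = p s.
Proof.
have [sO|sO] := boolP (s \in Omega_fin (V n.+1)).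
  rewrite /p -(comp (n := n.+2)) // -sum_mu_n_forbidden; apply: eq_bigl => t.
  by rewrite extendsE // sub_Vn.
rewrite [RHS]mu_n_forbidden // big1 // => t /eqP rt; apply: mu_n_forbidden.
by apply: contra sO => tO; rewrite -rt restriction_admissible.
Qed.

Let cell n (s : conf (V n.+1)) (u : R) : bool := in_cell (C := fun n => conf (V n.+1)) r p s u.

Let cell_exists n u : 0 <= u < 1 -> exists s : conf (V n.+1), cell s u.
Proof. exact: in_cell_exists. Qed.

(** The configurations whose cells contain u are restrictions of one another and glue to a
    configuration on the whole tree. *)
Lemma limit_configuration u : 0 <= u < 1 ->
  exists w : Omega T, forall n, cell (restr (V n.+1) w) u.
Proof.
move=> u01; pose X n := xchoose (cell_exists n u01).
have XP n : cell (X n) u by exact: (xchooseP (cell_exists n u01)).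
have rX n : r (X n.+1) = X n.
  by apply: (in_cell_inj p_ge0 p_sumS _ (XP n)); exact: (in_cellS p_ge0 p_sumS (XP n.+1)).
have XE m n x : (m <= n)%N -> x \in V m.+1 -> totalize (X n) x = totalize (X m) x.
  move=> mn xV; rewrite -(subnKC mn); elim: (n - m)%N => [|d IH]; first by rewrite addn0.
  rewrite addnS -IH -(rX (m + d)%N) /r totalize_restriction //.
  by apply: (fsubsetP (sub_Vn T _)) xV; rewrite ltnS leq_addr.
(* An inadmissible configuration labels an empty cell, which cannot contain u. *)
have XO n : X n \in Omega_fin (V n.+1).
  apply: contraT => /mu_n_forbidden X0; have := XP n.
  by rewrite /cell /in_cell /p X0 addr0 => /andP[a b]; move: (le_lt_trans a b); rewrite ltxx.
pose w x := totalize (X (depth x)) x.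
have wE n x : x \in V n.+1 -> w x = totalize (X n) x.
  move=> xV; have [le|/ltnW le] := leqP (depth x) n; last exact: XE.
  by rewrite /w -(XE _ n) // mem_Vn.
have w_adm x y : adj T x y -> allowed (w x) (w y).
  move=> axy; pose n := maxn (depth x) (depth y).
  have xV : x \in V n.+1 by rewrite mem_Vn leqW // leq_maxl.
  have yV : y \in V n.+1 by rewrite mem_Vn leqW // leq_maxr.
  rewrite (wE n) // (wE n) //; have := XO n; rewrite inE => /forallP/(_ [` xV]%fset).
  move=> /forallP/(_ [` yV]%fset)/implyP/(_ axy).
  by rewrite -!totalizeE.
exists (exist _ w w_adm) => n.
suff -> : restr (V n.+1) (exist _ w w_adm) = X n by exact: XP.
by apply/restrE => x xV /=; exact: wE.
Qed.

(** Outside [0, 1[, where the restricted Lebesgue measure has no mass, the value is a default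
    configuration. *)
Let config (u : R) : Omega T :=
  if pselect (0 <= u < 1) is left u01 then sval (cid (limit_configuration u01)) else point.

Let configE u n (s : conf (V n.+1)) : 0 <= u < 1 ->
  (restr (V n.+1) (config u) == s) = cell s u.
Proof.
move=> u01; rewrite /config; case: pselect => // u01'.
have := svalP (cid (limit_configuration u01')) n; set w := sval _ => wu.
apply/eqP/idP => [<- //|su]; exact: (in_cell_inj p_ge0 p_sumS wu su).
Qed.

Let preimage_cylinder n (s : conf (V n.+1)) :
  config @^-1` cylinder s `&` `[0, 1[%classic =
  `[left_end (C := fun n => conf (V n.+1)) r p s,
    left_end (C := fun n => conf (V n.+1)) r p s + p s[%classic.
Proof.
have [l0 l1] := in_cell01 p_ge0 p_sum0 p_sumS s.
apply/seteqP; split=> u /=; rewrite !in_itv /=.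
  by move=> [/eqP + u01]; rewrite configE.
move=> su; have u01 : 0 <= u < 1.
  by case/andP: su => a b; rewrite (le_trans l0 a) (lt_le_trans b l1).
by split=> //; apply/eqP; rewrite configE.
Qed.

Let config_measurable : measurable_fun setT (config : measurableTypeR R -> OmegaM T).
Proof.
apply: (@measurability _ _ _ (OmegaM T) _ _ (@evaluations k T) erefl) => _ [_ [x [i ->]] <-].
rewrite setTI (@evaluation_cylinders _ _ (depth x).+1) ?mem_Vn //.
rewrite preimage_bigcup; apply: fin_bigcup_measurable; first exact: finite_finset.
move=> s _; rewrite -(setIT (_ @^-1` _)) -(setUv `[0 : R, 1[%classic) setIUr.
apply: measurableU; first by rewrite preimage_cylinder; exact: measurable_itv.
(* Outside [0, 1[ the map is constant, so this part of the preimage is the whole complement or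
   empty. *)
have [ps|ps] := pselect (cylinder s point).
  rewrite setIidr; first by apply: measurableC; exact: measurable_itv.
  by move=> u /=; rewrite in_itv /= => u01; rewrite /config; case: pselect.
rewrite (_ : _ `&` _ = set0); first exact: measurable0.
apply/seteqP; split=> // u [/=]; rewrite in_itv /= /config.
by case: pselect.
Qed.

Lemma SGM_exists : c ord_max = 1 -> exists mu, is_SGM theta (fun _ : T => c) mu.
Proof.
move=> cm; have [mu muE] := unit_interval_pushforward config_measurable.
exists mu; split=> // [[//|n]] _ s _.
rewrite -/(cylinder s) muE; last exact: cylinder_measurable.
rewrite preimage_cylinder lebesgue_measure_itv /= lte_fin.
rewrite ltrDl; case: ifPn => [_|]; first by rewrite -EFinB addrAC subrr add0r.
by rewrite -leNgt => ps; congr EFin; apply/eqP; rewrite eq_le ps p_ge0.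
Qed.

End Existence.

(** * From solutions of the system to measures *)

Definition boundary_law {R : realType} (z : R * R) (i : 'I_3) : R := [:: z.1; z.2; 1]`_i.

Lemma fixed_point_sos {R : realType} (theta : R) (z : R * R) : 0 < theta ->
  (forall i, 0 < boundary_law z i) ->
  fixed_point (k := 2) theta (boundary_law z) <-> sos_system theta z.
Proof.
move=> t0 z0; set c := boundary_law z.
have local_fieldE i : local_field theta c i =
    activity theta i ord0 * z.1 + activity theta i (inord 1) * z.2 + activity theta i ord_max.
  rewrite /local_field 3!big_ord_recl big_ord0 addr0 addrA /c /boundary_law /= mulr1.
  by congr (_ + _ * _ + _); congr (activity _ _ _); apply/val_inj; rewrite /= ?inordK.
have f0 : local_field theta c ord0 = z.1 + theta * z.2.
  by rewrite local_fieldE /activity -!val_eqE /= !inordK //= mul1r addr0.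
have f1 : local_field theta c (inord 1) = theta * z.1 + z.2 + theta.
  by rewrite local_fieldE /activity -!val_eqE /= !inordK //= mul1r.
have f2 : local_field theta c ord_max = theta * z.2 + 1.
  by rewrite local_fieldE /activity -!val_eqE /= !inordK //= mul0r add0r.
have [z1 z2] : 0 < z.1 /\ 0 < z.2.
  by split; [have := z0 ord0 | have := z0 (inord 1)]; rewrite /boundary_law /= ?inordK.
have D0 : (theta * z.2 + 1) ^+ 2 != 0.
  by rewrite gt_eqF // exprn_gt0 // addr_gt0 // mulr_gt0.
have divE a b : b = (a / (theta * z.2 + 1)) ^+ 2 <-> a ^+ 2 = (theta * z.2 + 1) ^+ 2 * b.
  rewrite expr_div_n; split=> [->|->]; first by rewrite mulrC divfK.
  by rewrite mulrC mulKf.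
split=> [fp|[_ _ /divE e1 /divE e2]].
  split=> //; apply/divE.
    by have := fp ord0; rewrite f0 f2.
  by have := fp (inord 1); rewrite f1 f2 /c /boundary_law /= inordK.
case=> [[|[|[|//]]] h]; set i := Ordinal h.
- have -> : i = ord0 by apply/val_inj.
  by rewrite f0 f2.
- have -> : i = inord 1 by apply/val_inj; rewrite /= inordK.
  by rewrite f1 f2 /c /boundary_law /= inordK.
- have -> : i = ord_max by apply/val_inj.
  by rewrite /c /boundary_law /= mulr1.
Qed.

(** Each solution gives a measure, and distinct solutions differ already on the unit ball.
    Conversely the boundary law of a translation-invariant measure solves the system, and the
    measure agrees on cylinders with the listed one. *)
Lemma exactly_TISGM (R : realType) (T : cayley_tree 2) (theta : R) (s : seq (R * R)) :
  0 < theta -> uniq s -> (forall z, z \in s <-> sos_system theta z) ->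
  exactly (size s) (@is_TISGM 2 T R theta).
Proof.
move=> t0 us sP.
have law_gt0 z : z \in s -> forall i, 0 < boundary_law z i.
  by move=> /sP[z1 z2 _ _] [[|[|[|//]]] ?]; rewrite /boundary_law.
have ex z : z \in s -> exists mu, is_SGM theta (fun _ : T => boundary_law z) mu.
  move=> zs; apply: SGM_exists => //; first exact: law_gt0.
  apply: fixed_point_compatible => //; first exact: law_gt0.
  by apply/fixed_point_sos; [ | exact: law_gt0 | apply/sP].
have nths (i : 'I_(size s)) : s`_i \in s by exact: mem_nth.
pose mus i := sval (cid (ex _ (nths i))).
have musP (i : 'I_(size s)) : is_SGM theta (fun _ : T => boundary_law s`_i) (mus i).
  exact: svalP (cid (ex _ (nths i))).
exists mus; split=> [i|i j same|mu [c [zc comp muE]]].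
- by exists (boundary_law s`_i).
- apply/val_inj/eqP; rewrite -(nth_uniq 0 (ltn_ord i) (ltn_ord j) us); apply/eqP.
  have [_ _ mui] := musP i; have [_ _ muj] := musP j.
  have law_eq : forall l, boundary_law s`_i l = boundary_law s`_j l.
    apply: (mu_n_inj (T := T) t0) => //; try exact: law_gt0.
    move=> t tO; apply: EFin_inj; rewrite -mui // -muj //; apply: same.
    exact: cylinder_measurable.
  have := law_eq ord0; have := law_eq (inord 1); rewrite /boundary_law /= inordK //=.
  by case: s`_i => a b; case: s`_j => a' b' /= -> ->.
(* Positivity and normalisation are stated off the root; a vertex at depth 1 transfers them to
   [c]. *)
- have [x dx] := root_neighbor T.
  have [c0 cm] : (forall i, 0 < c i) /\ c ord_max = 1.
    by apply: (zc x); rewrite -depth_eq0 dx.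
  pose z := (c ord0, c (inord 1)).
  have cE : c = boundary_law z.
    apply/funext => -[[|[|[|//]]] h]; rewrite /boundary_law /=.
    + by congr c; apply/val_inj.
    + by congr c; apply/val_inj; rewrite /= inordK.
    + by rewrite -cm; congr c; apply/val_inj.
  have zs : z \in s.
    apply/sP/fixed_point_sos => //; rewrite -cE //.
    exact: (compatible_fixed_point (T := T)).
  have iP : (index z s < size s)%N by rewrite index_mem.
  exists (Ordinal iP); apply: same_measure_cylinders => n n0 t tO.
  have [_ _ musE] := musP (Ordinal iP).
  rewrite [LHS]muE // [RHS]musE //= nth_index // -cE //.
Qed.

Theorem proposition1 (R : realType) (T : cayley_tree 2) :
  exists theta0 theta0' : R,
    [/\ `|theta0 - 135 / 1000| < 5 / 10000,
        theta0' = (Num.sqrt 5 - 1) / 4,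
        `|theta0' - 309 / 1000| < 5 / 10000 &
        forall theta : R, 0 < theta ->
        [/\ theta0' < theta -> exactly 1 (@is_TISGM 2 T R theta),
            theta = theta0' -> exactly 3 (@is_TISGM 2 T R theta),
            theta0 < theta < theta0' -> exactly 5 (@is_TISGM 2 T R theta),
            theta = theta0 -> exactly 6 (@is_TISGM 2 T R theta) &
            theta < theta0 -> exactly 7 (@is_TISGM 2 T R theta)]].
Proof.
have [theta0 [theta0_approx count]] := @sos_system_count R.
exists theta0, theta0'; split=> //; first exact: theta0'_approx.
move=> theta t0; have [s [us sP [s1 s3 s5 s6 s7]]] := count theta t0.
have exact_s := exactly_TISGM T t0 us sP.
by split=> h; move: exact_s;
  [rewrite (s1 h)|rewrite (s3 h)|rewrite (s5 h)|rewrite (s6 h)|rewrite (s7 h)].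
Qed.
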